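(* Let $H$ be a hypergraph, and let $k$ be the number of connected components of $H$ that contain at least one non-singleton hyperedge. Then $$Z(IG(H)) \leq b_L(H) + |E(H)| - k,$$ where $IG(H)$ is the incidence graph of $H$, $Z$ denotes the zero forcing number of a graph, and $b_L(H)$ is the lazy burning number of $H$.
   Context: All graphs are finite, undirected and simple; all hypergraphs are finite. A hypergraph $H$ consists of a non-empty vertex set $V(H)$ and a collection $E(H)$ of subsets of $V(H)$, called hyperedges. A hyperedge containing exactly one vertex is called singleton; here a non-singleton hyperedge means one with at least two vertices. The connected components of $H$ are its maximal connected subhypergraphs: two vertices lie in the same component if and only if they are joined by a sequence of vertices in which consecutive vertices lie in a common hyperedge. A component contains a hyperedge if that hyperedge contains some vertex of the component. A component may have no hyperedges (an isolated vertex). The incidence graph $IG(H)$ is the bipartite graph with vertex set the disjoint union $V(H)\cup E(H)$ and edge set $\{vh \mid v\in V(H),\ h\in E(H),\ v\in h\}$. Lazy burning: a set $B\subseteq V(H)$ is chosen to be burned in the first round, and no other vertices are chosen later. In each later round, an unburned vertex $v$ becomes burned if and only if there is a non-singleton hyperedge $h\in E(H)$ with $v\in h$ such that all vertices of $h$ other than $v$ were burned at the end of the previous round. Burned vertices remain burned. $B$ is a lazy burning set if all vertices of $H$ eventually become burned. The lazy burning number $b_L(H)$ is the minimum cardinality of a lazy burning set of $H$. Zero forcing: in a graph $G$, a subset $B$ of vertices is initially blue and all other vertices are white. Color change rule: at each step, a blue vertex with exactly one white neighbor forces that neighbor to become blue. Vertices otherwise keep their color. $B$ is a zero forcing set if iterating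 the rule turns all of $V(G)$ blue. The zero forcing number $Z(G)$ is the minimum cardinality of a zero forcing set of $G$. *)

(* Defs.v *)
From HB Require Import structures.
From mathcomp Require Import all_boot all_order all_algebra.

Set Implicit Arguments.
Unset Strict Implicit.
Unset Printing Implicit Defensive.

(* Hyperedges are an indexed family, so repeated hyperedges are allowed and
   #|hyperedge H| counts them with multiplicity; a hypergraph whose hyperedges
   form a set is the case where [ends] is injective. Empty hyperedges are
   allowed too. *)
Record hypergraph := Hypergraph {
  vertex : finType;
  hyperedge : finType;
  ends : hyperedge -> {set vertex};
  vertex_gt0 : 0 < #|vertex|
}.

Record sgraph := SGraph {
  node : finType;
  adj : rel node;
  adj_sym : symmetric adj;
  adj_irrefl : irreflexive adj
}.

Section Eventually.
Variables (T : finType) (step : {set T} -> {set T}).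

(* The bound #|T| on the number of rounds only serves to make this decidable;
   see [eventually_fullP]. *)
Definition eventually_full (B : {set T}) : bool :=
  [exists t : 'I_#|T|.+1, iter t step B == [set: T]].

Lemma eventually_fullP (B : {set T}) :
  (forall A : {set T}, A \subset step A) ->
  reflect (exists t, iter t step B = [set: T]) (eventually_full B).
Proof.
move=> sub_step; apply: (iffP existsP) => [[t /eqP Bt] | ex_t].
  by exists t.
have {}ex_t: exists t, iter t step B == [set: T].
  by case: ex_t => t Bt; exists t; apply/eqP.
pose m := ex_minn ex_t.
have [/eqP Bm min_m]: iter m step B == [set: T] /\
    forall t, iter t step B == [set: T] -> m <= t.
  by rewrite /m; case: ex_minnP.
have grow t : t <= m -> t <= #|iter t step B|.
  elim: t => // t IHt lt_tm; apply: leq_ltn_trans (IHt (ltnW lt_tm)) _.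
  apply: proper_card; rewrite properEneq /= sub_step andbT.
  apply/eqP => fix_t.
  have stable s : iter (s + t) step B = iter t step B.
    by elim: s => // s IHs; rewrite addSn /= IHs -fix_t.
  have := min_m t; rewrite -(stable (m - t)) subnK ?(ltnW lt_tm) // Bm eqxx.
  by move=> /(_ isT); rewrite leqNgt lt_tm.
have lt_m : m < #|T|.+1 by rewrite ltnS -cardsT -Bm; apply: grow.
by exists (Ordinal lt_m); apply/eqP.
Qed.
End Eventually.

Section ZeroForcing.
Variable G : sgraph.
Implicit Types (B : {set node G}) (u w : node G).

Definition white_neighbors B u : {set node G} :=
  [set w | adj u w & w \notin B].

(* All possible forces are performed simultaneously. *)
Definition force_step B : {set node G} :=
  B :|: [set w | [exists u in B, white_neighbors B u == [set w]]].

Definition zero_forcing_set B : bool := eventually_full force_step B.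

Definition zero_forcing_number : nat :=
  #|[arg min_(B < [set: node G] | zero_forcing_set B) #|B|]|.

Lemma zero_forcing_setP B :
  reflect (exists t, iter t force_step B = [set: node G]) (zero_forcing_set B).
Proof. by apply: eventually_fullP => A; apply: subsetUl. Qed.

Lemma zero_forcing_setT : zero_forcing_set [set: node G].
Proof. by apply/zero_forcing_setP; exists 0. Qed.
End ZeroForcing.

Section Hypergraph.
Variable H : hypergraph.
Implicit Types (B : {set vertex H}) (v : vertex H) (h : hyperedge H).

Definition nonsingleton h : bool := 1 < #|ends h|.

Definition lazy_step B : {set vertex H} :=
  B :|: [set v | [exists h, [&& nonsingleton h, v \in ends h
                              & ends h :\ v \subset B]]].

Definition lazy_burning_set B : bool := eventually_full lazy_step B.

Definition lazy_burning_number : nat :=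
  #|[arg min_(B < [set: vertex H] | lazy_burning_set B) #|B|]|.

Lemma lazy_burning_setP B :
  reflect (exists t, iter t lazy_step B = [set: vertex H])
          (lazy_burning_set B).
Proof. by apply: eventually_fullP => A; apply: subsetUl. Qed.

Lemma lazy_burning_setT : lazy_burning_set [set: vertex H].
Proof. by apply/lazy_burning_setP; exists 0. Qed.

Definition coedge : rel (vertex H) :=
  fun x y => [exists h, (x \in ends h) && (y \in ends h)].

(* A connected component is represented by its vertex set. *)
Definition component v : {set vertex H} := [set w | connect coedge v w].

Definition components : {set {set vertex H}} :=
  [set component v | v : vertex H].

Definition contains_hyperedge (C : {set vertex H}) h : bool :=
  ends h :&: C != set0.

Definition num_nonsingleton_components : nat :=
  #|[set C in components | [exists h, nonsingleton h && contains_hyperedge C h]]|.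

Definition incidence_adj : rel (vertex H + hyperedge H) :=
  fun a b => match a, b with
             | inl v, inr h | inr h, inl v => v \in ends h
             | _, _ => false
             end.

Lemma incidence_adj_sym : symmetric incidence_adj.
Proof. by case=> [v|h] [w|g]. Qed.

Lemma incidence_adj_irrefl : irreflexive incidence_adj.
Proof. by case. Qed.

Definition incidence_graph : sgraph :=
  SGraph incidence_adj_sym incidence_adj_irrefl.
End Hypergraph.

(* Main.v *)
Require Import Defs.
From mathcomp Require Import all_boot all_order all_algebra.
Set Implicit Arguments.
Unset Strict Implicit.
Unset Printing Implicit Defensive.
Import GRing.Theory Num.Theory.
Local Open Scope ring_scope.

(** Let B be a minimum lazy burning set.  Every component C with a non-singleton
    hyperedge contains a vertex of B lying in some hyperedge; choose one such
    hyperedge h_C for each C.  Colour blue the set B together with all hyperedges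
    except the h_C.  A vertex of B on h_C has h_C as its only white neighbour, so
    after one round all hyperedges are blue; from then on a hyperedge forces
    its last white vertex whenever lazy burning would burn it. *)

Section Components.
Variable H : hypergraph.
Implicit Types (B C D : {set vertex H}) (v w : vertex H) (h : hyperedge H).

Lemma coedge_sym : symmetric (@coedge H).
Proof. by move=> v w; apply: eq_existsb => h; rewrite andbC. Qed.

Lemma component_eq C v : C \in components H -> v \in C -> C = component v.
Proof.
case/imsetP=> x _ ->; rewrite inE => xv; apply/setP=> w; rewrite !inE.
exact: same_connect (sym_connect_sym coedge_sym) _ _ xv _.
Qed.
End Components.

Section IncidenceGraph.
Variables (H : hypergraph) (B : {set vertex H}).
Hypothesis burnB : lazy_burning_set B.
Implicit Types (C D : {set vertex H}) (X : {set hyperedge H}).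
Implicit Types (v w : vertex H) (h g : hyperedge H).

(** If [B] missed [C], no vertex of [C] could be the first to burn: a non-singleton hyperedge
    through it has a second vertex, again in [C], which would have to be burned already. *)
Lemma lazy_burning_set_meets_component C h :
    C \in components H -> nonsingleton h -> contains_hyperedge C h ->
  exists g, ends g :&: (B :&: C) != set0.
Proof.
move=> compC h_gt1 /set0Pn[x /setIP[xh xC]].
have closedC v w : v \in C -> coedge v w -> w \in C.
  by move=> vC vw; rewrite (component_eq compC vC) inE connect1.
have [BC0|/set0Pn[v /setIP[vB vC]]] := eqVneq (B :&: C) set0.
  have unburned t : iter t (@lazy_step H) B :&: C = set0.
    elim: t => // t IHt; apply/eqP/set0Pn=> -[v /setIP[vt vC]].
    move: vt; rewrite /= !inE => /orP[vt|/existsP[g /and3P[g_gt1 vg sub]]].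
      by move/setP/(_ v): IHt; rewrite !inE vt vC.
    have /card_gt0P[w wg] : (0 < #|ends g :\ v|)%N.
      by move: g_gt1; rewrite /nonsingleton (cardsD1 v) vg.
    have wt := subsetP sub w wg; case/setD1P: wg => _ wg.
    have wC : w \in C.
      by apply: closedC vC _; apply/existsP; exists g; rewrite vg.
    by move/setP/(_ w): IHt; rewrite !inE wt wC.
  have [t Bt] := lazy_burning_setP _ burnB.
  by move/setP/(_ x): (unburned t); rewrite Bt !inE xC.
(* Since [v] is connected to [x], either [v = x] and [h] serves, or the first edge of a path from
   [v] to [x] supplies the hyperedge. *)
suff [g vg] : exists g, v \in ends g.
  by exists g; apply/set0Pn; exists v; rewrite !inE vg vB.
move: xC; rewrite (component_eq compC vC) inE => /connectP[[|y p] /=].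
  by move=> _ <-; exists h.
by case/andP=> /existsP[g /andP[vg _]] _ _; exists g.
Qed.

Lemma exists_private_hyperedges :
  exists2 X : {set hyperedge H}, (num_nonsingleton_components H <= #|X|)%N
    & forall h, h \in X ->
        exists2 v, v \in B & forall g, g \in X -> (v \in ends g) = (g == h).
Proof.
(* The chosen hyperedge may be a singleton: it only has to contain a vertex of [B] that can force
   it. *)
pose f C := [pick h | ends h :&: (B :&: C) != set0].
rewrite /num_nonsingleton_components; set K := [set C in _ | _].
have K_comp C : C \in K -> C \in components H by rewrite inE => /andP[].
have fP C h : f C = Some h -> exists2 v, v \in ends h & v \in B :&: C.
  rewrite /f; case: pickP => // g /set0Pn[v /setIP[vg vBC]] [<-].
  by exists v.
have fK C : C \in K -> exists h, f C = Some h.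
  rewrite inE => /andP[compC /exists_inP[h h_gt1 Ch]].
  have [g gBC] := lazy_burning_set_meets_component compC h_gt1 Ch.
  by rewrite /f; case: pickP => [e _|/(_ g)]; [exists e | rewrite gBC].
(* A hyperedge meets only one component. This yields both the injectivity of the choice and the
   privacy of the chosen vertex of [B]. *)
have f_inj C D g v :
    C \in K -> D \in K -> f D = Some g -> v \in C -> v \in ends g -> C = D.
  move=> /K_comp compC /K_comp compD fD vC vg.
  have [w wg /setIP[_ wD]] := fP _ _ fD.
  rewrite (component_eq compD wD); apply: component_eq => //.
  rewrite (component_eq compC vC) inE connect1 //.
  by apply/existsP; exists g; rewrite vg.
pose X := [set h | [exists C in K, f C == Some h]].
have XP h : h \in X -> exists2 C, C \in K & f C = Some h.
  by rewrite inE => /exists_inP[C CK /eqP fC]; exists C.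
exists X => [|h /XP[C CK fC]].
  have f_in_K : {in K &, injective f}.
    move=> C D CK DK fCD; have [h fC] := fK C CK.
    have [v vh /setIP[_ vC]] := fP _ _ fC.
    by apply: (f_inj C D h v) => //; rewrite -fCD.
  (* As [f] takes values in an option type, its image of [K] is compared with the image of [X] under
     [Some]. *)
  rewrite -(card_in_imset f_in_K) -(card_imset X (@Some_inj _)).
  apply/subset_leq_card/subsetP=> _ /imsetP[C CK ->].
  have [h fC] := fK C CK; rewrite fC imset_f // inE.
  by apply/exists_inP; exists C; rewrite ?fC.
have [v vh /setIP[vB vC]] := fP _ _ fC.
exists v => // g /XP[D DK fD]; apply/idP/eqP=> [vg|-> //].
have CD := f_inj _ _ _ _ CK DK fD vC vg.
by move: fC; rewrite CD fD => -[].
Qed.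

Definition blue_start X : {set node (incidence_graph H)} :=
  inl @: B :|: inr @: ~: X.

Lemma card_blue_start X :
  #|blue_start X| = (#|B| + (#|hyperedge H| - #|X|))%N.
Proof.
have inlI : injective (@inl (vertex H) (hyperedge H)) by move=> v w [].
have inrI : injective (@inr (vertex H) (hyperedge H)) by move=> h g [].
rewrite cardsU (card_imset _ inlI) (card_imset _ inrI) [#|~: X|]cardsCs setCK.
suff -> : inl @: B :&: inr @: (~: X) = set0 by rewrite cards0 subn0.
by apply/eqP/set0Pn=> -[a /setIP[/imsetP[v _ ->] /imsetP[h _]]].
Qed.

Lemma blue_start_zero_forcing X :
    (forall h, h \in X ->
       exists2 v, v \in B & forall g, g \in X -> (v \in ends g) = (g == h)) ->
  zero_forcing_set (blue_start X).
Proof.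
move=> privX; apply/zero_forcing_setP.
have start_inr h : (inr h \in blue_start X) = (h \notin X).
  rewrite inE orbC; case: imsetP => [[g gX [->]]|noh].
    by rewrite -in_setC gX.
  rewrite -in_setC; case: imsetP => [[]//|_].
  by symmetry; apply/negbTE/negP=> hX; apply: noh; exists h.
have blue_edges h : inr h \in force_step (blue_start X).
  rewrite inE start_inr; case: (boolP (h \in X)) => //= hX.
  have [v vB vX] := privX h hX.
  rewrite inE; apply/exists_inP; exists (inl v).
    by rewrite inE imset_f.
  apply/eqP/setP=> -[w|g]; rewrite in_set1 [LHS]inE // start_inr negbK.
  apply/andP/eqP=> [[vg gX]|[->]]; last by rewrite /= vX ?hX.
  by move: vg; rewrite /= vX // => /eqP->.
(* The shift to [t.+1] pays for the opening round that turns [X] blue; after it, forcing lags at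
   most one round behind burning. *)
have blue t : (forall h, inr h \in iter t.+1 (@force_step _) (blue_start X))
    /\ forall v, v \in iter t (@lazy_step H) B ->
         inl v \in iter t.+1 (@force_step _) (blue_start X).
  elim: t => [|t [IHh IHv]].
    by split=> // v vB; rewrite /= !inE imset_f.
  split=> [h|v]; first by rewrite iterS inE IHh.
  rewrite (iterS t) (iterS t.+1) [v \in _]inE => /orP[/IHv vt|].
    by rewrite inE vt.
  rewrite inE => /existsP[h /and3P[_ vh sub]].
  rewrite inE; case: (boolP (inl v \in _)) => //= vW.
  rewrite inE; apply/exists_inP; exists (inr h) => //.
  (* All vertices of [h] other than [v] were burned by round [t], hence are blue by induction, so
     [v] is the only white neighbor of [h]. *)
  apply/eqP/setP=> -[w|g]; rewrite in_set1 [LHS]inE //.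
  apply/andP/eqP=> [[wh wW]|[->]]; last by [].
  congr inl; apply/eqP; apply: contraNT wW => wv; apply: IHv.
  by apply: (subsetP sub); rewrite !inE wv.
have [t Bt] := lazy_burning_setP _ burnB.
exists t.+1; have [bh bv] := blue t.
apply/setP=> -[v|h]; rewrite [RHS]inE; last exact: bh.
by apply: bv; rewrite Bt inE.
Qed.
End IncidenceGraph.

Lemma zero_forcing_number_min (G : sgraph) (B : {set node G}) :
  zero_forcing_set B -> (zero_forcing_number G <= #|B|)%N.
Proof.
rewrite /zero_forcing_number; case: arg_minnP => [|A _ minA /minA //].
exact: zero_forcing_setT.
Qed.

Theorem theorem3p3 (H : hypergraph) :
  (zero_forcing_number (incidence_graph H))%:Z <=
    (lazy_burning_number H)%:Z + #|hyperedge H|%:Z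
      - (num_nonsingleton_components H)%:Z.
Proof.
rewrite /lazy_burning_number.
case: arg_minnP => [|B burnB _]; first exact: lazy_burning_setT.
have [X kX privX] := exists_private_hyperedges burnB.
(* With the component count moved to the left, the bound can be read in the naturals; the truncated
   difference in [card_blue_start] is exact because [X] is a set of hyperedges. *)
rewrite lerBrDr -!PoszD lez_nat.
have := zero_forcing_number_min (blue_start_zero_forcing burnB privX).
rewrite card_blue_start => leZ.
apply: leq_trans (leq_add leZ kX) _.
by rewrite -addnA subnK ?max_card.
Qed.
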